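(* Let $\mathfrak p$ be a property (of unordered hypergraphs, or of ordered hypergraphs) that allows $T_0$-filtration, and let $m\ge 0$, $n\ge 1$ be integers. Then $$\alpha^\ast_{\mathfrak p}(m,n)=\sum_{i=1}^{n}s_{n,i}\,\alpha_{\mathfrak p}(m,i),$$ where $s_{n,i}$ are the (signed) Stirling numbers of the first kind.
   Context: A (labelled) $(m,n)$-hypergraph $H$ consists of a linearly ordered vertex set $V=\{V[1]<\dots<V[n]\}$ with $n\ge1$ elements together with a finite family of $m$ subsets of $V$, called edges, which may be empty and may repeat. $H$ is ordered if the family is a sequence $(e_1,\dots,e_m)$, and unordered if the family is considered up to re-indexing (a multiset of $m$ subsets of $V$). Two hypergraphs are identified if the order-preserving bijection of their vertex sets carries one family to the other, so one counts $(m,n)$-hypergraphs on a fixed linearly ordered $n$-set. A hypergraph property is a property of such hypergraphs (all ordered, or all unordered), invariant under this identification. For vertices $u,v$ of $H$ write $u\sim_H v$ if every edge of $H$ contains either both or neither of $u,v$. $H$ is a $T_0$-hypergraph if $u\not\sim_H v$ for all distinct vertices $u,v$. $\alpha_{\mathfrak p}(m,n)$ is the number of $(m,n)$-hypergraphs with property $\mathfrak p$, and $\alpha^\ast_{\mathfrak p}(m,n)$ is the number of those which are $T_0$-hypergraphs. For a partition $\pi$ of $\{1,\dots,n\}$, $\alpha_{\mathfrak p}(m,n;\pi)$ is the number of $(m,n)$-hypergraphs $H$ with property $\mathfrak p$ such that $V[i]\sim_H V[j]$ whenever $i,j$ lie in the same class of $\pi$. The property $\mathfrak p$ is a regular $T_0$-property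 if, for all $m,n$, the value $\alpha_{\mathfrak p}(m,n;\pi)$ depends only on the number $k$ of classes of $\pi$; it is then denoted $\alpha_{\mathfrak p}(m,n;k)$. A regular $T_0$-property $\mathfrak p$ allows $T_0$-filtration if $\alpha_{\mathfrak p}(m,n;k)=\alpha_{\mathfrak p}(m,k)$ for every $k\in\{1,\dots,n\}$ (for all $m,n$). The signed Stirling numbers of the first kind are defined by $x(x-1)\cdots(x-n+1)=\sum_{i=0}^n s_{n,i}x^i$. *)

(* Defs.v *)
From HB Require Import structures.
From mathcomp Require Import all_boot all_order all_algebra.

Set Implicit Arguments.
Unset Strict Implicit.
Unset Printing Implicit Defensive.

Import GRing.Theory.

Variant kind := Ordered | Unordered.

(* The vertex set is the fixed linearly ordered set 'I_n: an identification of
   two hypergraphs is the unique order-preserving bijection of the vertex sets,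
   so it becomes equality, and invariance of a property is automatic.  An
   unordered family of m edges is a multiset, given by its multiplicities
   (each at most m, which keeps the type finite). *)
Definition hypergraph (o : kind) (m n : nat) : finType :=
  match o with
  | Ordered => m.-tuple {set 'I_n}
  | Unordered => {f : {ffun {set 'I_n} -> 'I_m.+1} | \sum_e f e == m}
  end.

Definition is_edge (o : kind) (m n : nat) :
    hypergraph o m n -> pred {set 'I_n} :=
  match o with
  | Ordered => fun (H : m.-tuple {set 'I_n}) e => e \in H
  | Unordered => fun (H : {f : {ffun {set 'I_n} -> 'I_m.+1} |
                             \sum_e f e == m}) e => 0 < val H e
  end.

(* Hypergraphs have n >= 1 vertices; the value of a property at n = 0 is never
   used, since every condition below is restricted to 0 < n. *)
Definition hproperty (o : kind) := forall m n : nat, pred (hypergraph o m n).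

Section Counting.
Variables (o : kind) (p : hproperty o).

Definition sim (m n : nat) (H : hypergraph o m n) (u v : 'I_n) : bool :=
  [forall e : {set 'I_n}, is_edge H e ==> ((u \in e) == (v \in e))].

Definition T0 (m n : nat) (H : hypergraph o m n) : bool :=
  [forall u, forall v, (u != v) ==> ~~ sim H u v].

Definition alpha (m n : nat) : nat :=
  #|[set H : hypergraph o m n | p H]|.

Definition alpha_star (m n : nat) : nat :=
  #|[set H : hypergraph o m n | p H && T0 H]|.

Definition alpha_part (m n : nat) (P : {set {set 'I_n}}) : nat :=
  #|[set H : hypergraph o m n | p H &&
      [forall B in P, forall i in B, forall j in B, sim H i j]]|.

Definition regular_T0 : Prop :=
  forall (m n : nat) (P Q : {set {set 'I_n}}), 0 < n ->
    partition P [set: 'I_n] -> partition Q [set: 'I_n] -> #|P| = #|Q| ->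
    alpha_part m P = alpha_part m Q.

(* For a regular property, alpha(m, n; k) is the common value of alpha_part m P
   over the partitions P of 'I_n into k classes (there is one iff 1 <= k <= n,
   when n >= 1). *)
Definition allows_T0_filtration : Prop :=
  regular_T0 /\
  forall (m n k : nat), 0 < n -> 1 <= k <= n ->
    forall P : {set {set 'I_n}},
      partition P [set: 'I_n] -> #|P| = k -> alpha_part m P = alpha m k.

End Counting.

Definition stirling1 (n i : nat) : int :=
  ((\prod_(j < n) ('X - (j%:R)%:P))`_i)%R.

(* Main.v *)
Require Import Defs.
From HB Require Import structures.
From mathcomp Require Import all_boot all_order all_algebra.
From mathcomp Require Import perm.

(** If [e] is an equivalence relation, the signs of the permutations moving
   each point inside its [e]-class sum to 0 unless [e] is equality, as one sees
   by composing with a transposition of two equivalent points. Applied to the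
   kernels of the maps ['I_n -> 'I_q], this identifies the sum of
   [sgn(s) X^(number of cycles of s)] with the falling factorial, so that
   [s_{n,k}] is the sum of the signs of the permutations with [k] cycles.
   Applied to the relations [~_H], it gives [alpha_star m n] as the sum over [s]
   of [sgn(s)] times the number of [H] in which each cycle of [s] lies in one
   [~_H]-class, and this number is [alpha m k] when [s] has [k] cycles. *)

Set Implicit Arguments.
Unset Strict Implicit.
Unset Printing Implicit Defensive.

Import GRing.Theory Num.Theory.

Lemma sum_sign_preserving (T : finType) (e : rel T) :
    equivalence_rel e ->
  (\sum_(s : {perm T} | [forall x, e x (s x)]) (-1) ^+ s
   = [forall x, forall y, (x != y) ==> ~~ e x y]%:R :> int)%R.
Proof.
move=> /equivalence_relP[e_refl e_tr].
case: (boolP [forall x, _]) => [/forallP e_discr | e_ndiscr].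
  rewrite (big_pred1 (1%g : {perm T})) ?odd_perm1 // => s.
  apply/forallP/eqP => [es|-> x].
    apply/permP=> x; rewrite perm1; apply/eqP; rewrite eq_sym.
    by apply: contraTT (es x); apply/implyP; apply/forallP: (s x).
  by rewrite perm1 e_refl.
have [x [y [neq_xy e_xy]]] : exists x y, x != y /\ e x y.
  move: e_ndiscr; rewrite negb_forall => /existsP[x].
  rewrite negb_forall => /existsP[y]; rewrite negb_imply negbK => /andP[? ?].
  by exists x, y.
have e_t z : e z (tperm x y z).
  by case: tpermP => [->|->|_ _] //; rewrite -(e_tr _ _ e_xy) e_refl.
set S := bigop _ _ _.
(* Multiplication by [tperm x y] reverses signs; it permutes the index set of [S] because
   [tperm x y z] is always [e]-related to [z]. *)
have: S = (- S)%R.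
  rewrite {1}/S (reindex_inj (mulgI (tperm x y))) /= -sumrN.
  apply: eq_big => [s | s _]; last first.
    by rewrite odd_mul_tperm neq_xy signr_addb mulN1r.
  apply/forallP/forallP => es z; have := es (tperm x y z);
    rewrite permM ?tpermK; first by rewrite -(e_tr _ _ (e_t _)).
  by rewrite -(e_tr _ _ (e_t _)).
by move/eqP; rewrite -addr_eq0 -mulr2n mulrn_eq0 => /eqP.
Qed.

Lemma porbit_preserved (T : finType) (e : rel T) (s : {perm T}) :
    equivalence_rel e -> [forall x, e x (s x)] ->
  forall x y, y \in porbit s x -> e x y.
Proof.
move=> /equivalence_relP[e_refl e_tr] /forallP es x _ /porbitP[i ->].
elim: i => [|i IHi]; first by rewrite perm1 e_refl.
by rewrite expgSr permM (e_tr _ _ IHi).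
Qed.

(** An invariant function is constant on each cycle of [s], so it amounts to a free choice of one
    value per cycle. *)
Lemma card_perm_invariant_ffun (T : finType) (q : nat) (s : {perm T}) :
  #|[set f : {ffun T -> 'I_q.+1} | [forall x, f x == f (s x)]]|
  = q.+1 ^ #|porbits s|.
Proof.
(* Functions on cycles are encoded as functions on all subsets of [T] forced to be [ord0] off
   [porbits s], so that [pull] is injective on them. *)
pose G := pffun_on (ord0 : 'I_q.+1) (porbits s) predT.
pose pull (g : {ffun {set T} -> 'I_q.+1}) := [ffun x => g (porbit s x)].
have -> : q.+1 ^ #|porbits s| = #|G| by rewrite card_pffun_on card_ord.
have pull_inj : {in G &, injective pull}.
  move=> g h /pffun_onP[/subsetP gP _] /pffun_onP[/subsetP hP _] /ffunP eq_gh.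
  apply/ffunP=> B; have [/imsetP[x _ ->]|BP] := boolP (B \in porbits s).
    by have := eq_gh x; rewrite !ffunE.
  have g0 : g B = ord0 by apply/eqP; apply: contraNT BP => /gP.
  by rewrite g0; apply/esym/eqP; apply: contraNT BP => /hP.
rewrite -(card_in_imset pull_inj); apply: eq_card => f; rewrite inE.
apply/idP/imsetP => [fs | [g _ ->]]; last first.
  by apply/forallP=> x; rewrite !ffunE -{3}[s]expg1 porbit_perm.
exists [ffun B : {set T} => if B \in porbits s
                            then oapp f ord0 [pick x in B] else ord0].
  apply/pffun_onP; split=> [|//]; apply/subsetP=> B.
  by rewrite inE ffunE; case: ifP; rewrite ?eqxx.
apply/ffunP=> x; rewrite !ffunE imset_f //.
case: pickP => [y xy | /(_ x)]; last by rewrite porbit_id.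
apply/eqP; apply: (@porbit_preserved _ (fun x y => f x == f y) s) => //.
by move=> u v w; split=> // /eqP->.
Qed.

Lemma prod_subr_ffact (q n : nat) :
  (\prod_(j < n) (q%:R - j%:R) = (q ^_ n)%:R :> int)%R.
Proof.
elim: n => [|n IHn]; first by rewrite big_ord0.
rewrite big_ord_recr /= IHn ffactnSr natrM.
(* The factor [q - n] is truncated when [q < n], but then [q ^_ n] is already 0. *)
have [le_nq | lt_qn] := leqP n q; first by rewrite natrB.
by rewrite ffact_small // !mul0r.
Qed.

(** Signed double count of the pairs [(s, f)] with [f] constant on the cycles of [s]: summing over
    [f] first gives the power, summing over [s] first leaves only the injective [f]. *)
Lemma sum_sign_exp_porbits (n q : nat) :
  (\sum_(s : 'S_n) (-1) ^+ s * q.+1%:R ^+ #|porbits s|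
   = (q.+1 ^_ n)%:R :> int)%R.
Proof.
transitivity (\sum_(s : 'S_n) \sum_(f : {ffun 'I_n -> 'I_q.+1} |
                [forall x, f x == f (s x)]) (-1) ^+ s : int)%R.
  apply: eq_bigr => s _; rewrite sumr_const -natrX -card_perm_invariant_ffun.
  by rewrite mulr_natr cardsE.
rewrite (exchange_big_dep predT) //=.
rewrite -[q.+1 in RHS]card_ord -[n in RHS]card_ord -card_inj_ffuns.
rewrite -sum1_card natr_sum [RHS]big_mkcond /=; apply: eq_bigr => f _.
rewrite (@sum_sign_preserving _ (fun x y => f x == f y)); last first.
  by move=> u v w; split=> // /eqP->.
rewrite inE (_ : [forall x, _] = injectiveb f); first by case: injectiveb.
apply/idP/injectiveP => [/forallP f_inj x y eq_f | f_inj].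
  apply/eqP; have /forallP/(_ y) := f_inj x.
  by rewrite eq_f eqxx implybF negbK.
by apply/forallP=> x; apply/forallP=> y; apply/implyP; rewrite (inj_eq f_inj).
Qed.

Lemma sum_sign_porbits (n : nat) :
  (\sum_(s : 'S_n) (-1) ^+ s *: 'X^#|porbits s|
   = \prod_(j < n) ('X - (j%:R)%:P) :> {poly int})%R.
Proof.
apply/eqP; rewrite -subr_eq0; apply/eqP; set d := (_ - _)%R.
(* The difference [d] vanishes at every positive integer, and [size d] distinct roots force it to be
   0. *)
apply: (@roots_geq_poly_eq0 _ _ [seq k.+1%:R%R | k <- iota 0 (size d)]).
- apply/allP=> _ /mapP[q _ ->]; rewrite rootE /d hornerD hornerN subr_eq0.
  rewrite horner_sum horner_prod.
  under [X in X == _]eq_bigr do rewrite hornerZ hornerXn.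
  under [X in _ == X]eq_bigr do rewrite hornerXsubC.
  by rewrite sum_sign_exp_porbits prod_subr_ffact.
- rewrite map_inj_uniq ?iota_uniq // => i j /eqP.
  by rewrite !natz eqz_nat eqSS => /eqP.
- by rewrite size_map size_iota.
Qed.

Lemma stirling1_sign (n k : nat) :
  stirling1 n k = (\sum_(s : 'S_n | #|porbits s| == k) (-1) ^+ s)%R.
Proof.
rewrite /stirling1 -sum_sign_porbits coef_sum [RHS]big_mkcond /=.
apply: eq_bigr => s _; rewrite coefZ coefXn eq_sym.
by case: eqP => _; rewrite ?mulr1 ?mulr0.
Qed.

Lemma partition_porbits (T : finType) (s : {perm T}) :
  partition (porbits s) [set: T].
Proof.
have -> : porbits s = preim_partition (porbit s) [set: T].
  apply/setP=> B; apply/imsetP/imsetP => -[x _ ->]; exists x => //;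
    by apply/setP=> y; rewrite !inE eq_porbit_mem porbit_sym.
exact: preim_partitionP.
Qed.

Lemma card_porbits_bounds (n : nat) (s : 'S_n) :
  0 < n -> 0 < #|porbits s| <= n.
Proof.
case: n s => // n s _; apply/andP; split; last first.
  by apply: leq_trans (leq_imset_card _ _) _; rewrite card_ord.
by apply/card_gt0P; exists (porbit s ord0); apply: imset_f.
Qed.

Section Sim.
Variables (o : kind) (m n : nat) (H : hypergraph o m n).

Lemma sim_equiv : equivalence_rel (sim H).
Proof.
move=> u v w; split=> [|/forallP uv].
  by apply/forallP=> e; rewrite eqxx implybT.
apply: eq_forallb => e; have := uv e.
by case: is_edge => //= /eqP->.
Qed.

(** Turns the condition counted by [alpha_part] on the cycle partition into the pointwise one of
    [sum_sign_preserving]. *)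
Lemma sim_porbits (s : 'S_n) :
  [forall B in porbits s, forall i in B, forall j in B, sim H i j]
  = [forall i, sim H i (s i)].
Proof.
apply/idP/idP => [/forall_inP simP | sim_s].
  apply/forallP=> i.
  have iP : porbit s i \in porbits s by apply: imset_f.
  have /forall_inP/(_ i (porbit_id s i))/forall_inP := simP _ iP.
  by apply; rewrite -{1}[s]expg1 mem_porbit.
apply/forall_inP=> _ /imsetP[x _ ->]; apply/forall_inP=> i xi.
apply/forall_inP=> j xj; apply: (porbit_preserved sim_equiv sim_s).
by move: xi; rewrite -eq_porbit_mem => /eqP->.
Qed.

End Sim.

(** For fixed [H], the signs of the [s] moving points within [sim H]-classes sum to the indicator of
    [T0 H]; the sums over [H] and [s] are then exchanged. *)
Lemma alpha_star_sign (o : kind) (p : hproperty o) (m n : nat) :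
  ((alpha_star p m n)%:Z
   = \sum_(s : 'S_n) (-1) ^+ s * (alpha_part p m (porbits s))%:Z)%R.
Proof.
transitivity (\sum_(s : 'S_n) \sum_(H : hypergraph o m n |
                p m n H && [forall i, sim H i (s i)]) (-1) ^+ s : int)%R.
  rewrite (exchange_big_dep (p m n)) /= => [|s H _ /andP[]//].
  rewrite -[LHS]natz /alpha_star -sum1_card natr_sum.
  under eq_bigl do rewrite inE.
  rewrite big_mkcondr /=; apply: eq_bigr => H pH.
  under [RHS]eq_bigl do rewrite pH.
  by rewrite (sum_sign_preserving (sim_equiv H)) -/(T0 H); case: T0.
apply: eq_bigr => s _; rewrite sumr_const -natz mulr_natr /alpha_part cardsE.
by congr (_ *+ _)%R; apply: eq_card => H; rewrite !unfold_in /= sim_porbits.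
Qed.

Theorem theorem3p4 (o : kind) (p : hproperty o) (m n : nat)
    (hp : allows_T0_filtration p) (hn : 0 < n) :
  ((alpha_star p m n)%:Z =
   \sum_(1 <= i < n.+1) stirling1 n i * (alpha p m i)%:Z)%R.
Proof.
case: hp => _ hp; rewrite alpha_star_sign.
under [RHS]eq_bigr do rewrite stirling1_sign mulr_suml.
rewrite (exchange_big_dep predT) //=; apply: eq_bigr => s _.
have /andP[k_gt0 le_kn] := card_porbits_bounds s hn.
rewrite (hp _ _ #|porbits s|) ?k_gt0 ?partition_porbits //.
(* Each [s] contributes only at the index [i = #|porbits s|], which lies between 1 and [n]. *)
under eq_bigl do rewrite eq_sym.
by rewrite big_nat1_eq k_gt0 ltnS le_kn.
Qed.
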